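(* For every odd prime $p>2$, \[ \sum_{n=0}^{p-1}\frac{(\frac{1}{2})_n(\frac{1}{3})_n(\frac{2}{3})_n}{(1)_n^3}\left(11n+3\right)\left(\frac{27}{16}\right)^n\equiv 3p \pmod{p^3}. \] Equivalently, $\sum_{n=0}^{p-1}\frac{11n+3}{64^n}\binom{2n}{n}^2\binom{3n}{n}\equiv 3p \pmod{p^3}$.
   Context: $(a)_n=\prod_{k=0}^{n-1}(a+k)$ denotes the Pochhammer symbol (rising factorial), with $(a)_0=1$. Congruences between rational numbers whose denominators are coprime to $p$ are understood in the ring of $p$-integral rationals. *)

(* Defs.v *)
From mathcomp Require Import all_boot all_order all_algebra.
Set Implicit Arguments. Unset Strict Implicit. Unset Printing Implicit Defensive.
Import Order.TTheory GRing.Theory Num.Theory.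
Local Open Scope ring_scope.

Definition poch (a : rat) (n : nat) : rat := \prod_(k < n) (a + k%:R).

Definition p_integral (p : nat) (x : rat) : bool := coprime p `|denq x|%N.

Definition rat_congr (p : nat) (m x y : rat) : bool := p_integral p ((x - y) / m).

(* Main.v *)
(** Write [f m j = C(m,j) C(2m+1,j)] and [c m = 24 (1/2)_{m+1}^3 / (m! (2m+1)!)].
    With [A_n = (1/2)_n (1/3)_n (2/3)_n / n!^3 (27/16)^n], the partial sums are
      [sum_(n <= m) A_n (11n+3) = c m * sum_(j <= m) f m j / (2m+1-2j)]:
    in the difference of two consecutive right-hand sides the denominator
    cancels, because [x^3 - 8 j^2 x + 8 j^3 = (x - 2j)(x^2 + 2jx - 4j^2)] with
    [x = 2m+1], and the remaining sum of [f m j] against a quadratic in [j] is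
    evaluated by Vandermonde's convolution.
    Take [m = p-1] and [p = 2h+1]. Then [c m] is divisible by [p^2]. The terms
    [j <> h] add up to [0] mod [p], since [f m j = 1] mod [p] and the
    denominators at [j] and [2h-j] add up to [2p]; so only [j = h], with
    denominator [p], matters mod [p^3]. It contributes [3 p Q^3 / (h!^4 R)], where
    [Q = prod (i^2 - p^2/4)] and [R = prod (i^2 - p^2)] over [1 <= i <= h] are
    both [h!^2] mod [p^2]. *)
Require Import Defs.
From mathcomp Require Import all_boot all_order all_algebra.
From mathcomp Require Import ring lra zify.
Import Order.TTheory GRing.Theory Num.Theory.
Local Open Scope ring_scope.

(** * Vandermonde's convolution *)

Lemma vandermonde_shift (l n s K : nat) : (n < K + s)%N ->
  (\sum_(j < K) 'C(n, j + s) * 'C(l, j) = 'C(n + l, l + s))%N.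
Proof.
elim: l s K => [|l IHl] s [|K] ltn.
- by rewrite big_ord0 bin_small //; lia.
- rewrite big_ord_recl bin0 muln1 big1 ?addn0 // => i _.
  by rewrite bin0n muln0.
- by rewrite big_ord0 bin_small //; lia.
(* Pascal's rule on ['C(l.+1, j.+1)]: one half is the induction hypothesis at shift [s.+1], the
   other, joined with the term [j = 0], the one at shift [s]. The bound [n < K + s] ensures that no
   nonzero term is cut off. *)
rewrite big_ord_recl /= bin0.
under eq_bigr => j _ do rewrite (_ : bump 0 j = j.+1) // binS mulnDr.
rewrite big_split /= addnA.
have -> : (\sum_(j < K) 'C(n, j.+1 + s) * 'C(l, j) = 'C(n + l, l + s.+1))%N.
  rewrite -(IHl s.+1 K); last by lia.
  by apply: eq_bigr => j _; rewrite /bump /= addSnnS.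
rewrite [X in (X + _)%N](_ : _ = 'C(n + l, l + s))%N.
  by rewrite addnS addSn addnS binS addnC.
rewrite -(IHl s K.+1) // big_ord_recl /= bin0; congr (_ + _)%N.
Qed.

(** * Pochhammer symbols as factorials, and the summand *)

Lemma natrS_neq0 (n : nat) : (n.+1%:R : rat) != 0.
Proof. by rewrite pnatr_eq0. Qed.

Lemma fact_neq0 (n : nat) : (n`!%:R : rat) != 0.
Proof. by rewrite pnatr_eq0 -lt0n fact_gt0. Qed.

Lemma pochS (a : rat) n : poch a n.+1 = poch a n * (a + n%:R).
Proof. by rewrite /poch big_ord_recr. Qed.

Lemma poch1 n : poch 1 n = n`!%:R.
Proof.
elim: n => [|n IHn]; first by rewrite /poch big_ord0.
by rewrite pochS IHn factS natrM; ring.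
Qed.

Lemma poch_half n : poch (1 / 2) n * 4 ^+ n * n`!%:R = (2 * n)`!%:R.
Proof.
elim: n => [|n IHn]; first by rewrite /poch big_ord0 !mul1r.
rewrite (_ : 2 * n.+1 = (2 * n).+2)%N; last by lia.
by rewrite pochS !factS !natrM -IHn exprS; field.
Qed.

Lemma poch_third n :
  poch (1 / 3) n * poch (2 / 3) n * 27 ^+ n * n`!%:R = (3 * n)`!%:R.
Proof.
elim: n => [|n IHn]; first by rewrite /poch !big_ord0 !mul1r.
rewrite (_ : 3 * n.+1 = (3 * n).+3)%N; last by lia.
by rewrite !pochS !factS !natrM -IHn exprS; field.
Qed.

Lemma bin_3n n : 'C(3 * n, 2 * n)%:R = ((3 * n)`!%:R : rat) / ((2 * n)`!%:R * n`!%:R).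
Proof.
rewrite -(@bin_fact (3 * n) (2 * n)); last by lia.
rewrite (_ : 3 * n - 2 * n = n)%N; last by lia.
rewrite !natrM mulfK // mulf_neq0 ?fact_neq0 //.
Qed.

Definition ram_coef (n : nat) : rat :=
  poch (1/2) n * poch (1/3) n * poch (2/3) n / (poch 1 n) ^+ 3 * (27/16) ^+ n.

(** Trading 16^n for two more factors (1/2)_n leaves the cube that occurs in [ram_factor] and a
    binomial of the kind Vandermonde's convolution produces. *)
Lemma ram_coefE n : ram_coef n =
  poch (1/2) n ^+ 3 * 'C(3 * n, 2 * n)%:R / (n`!%:R * (2 * n)`!%:R).
Proof.
rewrite /ram_coef bin_3n -poch_third -poch_half poch1 expr_div_n.
have -> : (16 : rat) ^+ n = 4 ^+ n * 4 ^+ n by rewrite -exprMn; congr (_ ^+ _); ring.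
have h0 : poch (1 / 2) n != 0.
  apply: contraNneq (fact_neq0 (2 * n)) => h0.
  by rewrite -poch_half h0 !mul0r.
have f0 := fact_neq0 n.
have q0 : (4 : rat) ^+ n != 0 by rewrite expf_neq0.
by field; rewrite f0 q0 h0.
Qed.

(** * Moments of the product of binomials *)

Lemma bin_moment0 m : (\sum_(j < m.+1) 'C(m, j) * 'C((2 * m).+1, j) = 'C((3 * m).+1, (2 * m).+1))%N.
Proof.
under eq_bigr => j _ do rewrite -{1}(addn0 j).
rewrite vandermonde_shift; last by lia.
by congr 'C(_, _); lia.
Qed.

(** Absorption, j C(2m+1,j) = (2m+1) C(2m,j-1), reduces this to the convolution with shift 1. *)
Lemma bin_moment1 m : (\sum_(j < m.+1) j * ('C(m, j) * 'C((2 * m).+1, j)) =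
  (2 * m).+1 * 'C(3 * m, (2 * m).+1))%N.
Proof.
rewrite big_ord_recl mul0n add0n.
rewrite (_ : 'C(_, _) = \sum_(j < m) 'C(m, j + 1) * 'C(2 * m, j))%N; last first.
  by rewrite vandermonde_shift ?addn1 //; congr 'C(_, _); lia.
rewrite big_distrr; apply: eq_bigr => j _ /=.
by rewrite /bump /= add1n addn1 mulnCA -mul_bin_diag mulnCA.
Qed.

(** Both factors of j(j-1) are absorbed into the second binomial, leaving shift 2. *)
Lemma bin_moment2 m : (\sum_(j < m.+2) j * j.-1 * ('C(m.+1, j) * 'C((2 * m.+1).+1, j)) =
  (2 * m.+1).+1 * (2 * m.+1) * 'C((3 * m).+2, (2 * m.+1).+1))%N.
Proof.
rewrite big_ord_recl !mul0n add0n big_ord_recl /= muln0 mul0n add0n.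
rewrite (_ : 'C((3 * m).+2, _) = \sum_(j < m) 'C(m.+1, j + 2) * 'C((2 * m).+1, j))%N; last first.
  by rewrite vandermonde_shift ?addn2 //; congr 'C(_, _); lia.
rewrite big_distrr; apply: eq_bigr => j _ /=.
rewrite /bump /= !add1n addn2.
have e1 := mul_bin_diag (2 * m.+1).+1 j.+1.
have e2 := mul_bin_diag (2 * m.+1) j.
rewrite (_ : (2 * m.+1).-1 = (2 * m).+1)%N in e2; last by lia.
transitivity (j.+1 * 'C(m.+1, j.+2) * (j.+2 * 'C((2 * m.+1).+1, j.+2)))%N.
  by ring.
rewrite -e1 /=.
transitivity ((2 * m.+1).+1 * 'C(m.+1, j.+2) * (j.+1 * 'C(2 * m.+1, j.+1)))%N.
  by ring.
by rewrite -e2; ring.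
Qed.

(** In falling factorials the quadratic is x^2 + (2x-4) j - 4 j(j-1), so the three moments evaluate
    the sum. *)
Lemma bin_weighted_sum m :
  \sum_(j < m.+2) ('C(m.+1, j) * 'C((2 * m.+1).+1, j))%:R *
     ((2 * m.+1).+1%:R ^+ 2 + 2 * j%:R * (2 * m.+1).+1%:R - 4 * j%:R ^+ 2)
  = 'C(3 * m.+1, 2 * m.+1)%:R * (11 * m.+1%:R + 3) * (2 * m.+1).+1%:R / 3 :> rat.
Proof.
set x : rat := (2 * m.+1).+1%:R.
transitivity (x ^+ 2 * ('C((3 * m.+1).+1, (2 * m.+1).+1))%:R
  + (2 * x - 4) * ((2 * m.+1).+1 * 'C(3 * m.+1, (2 * m.+1).+1))%:R
  - 4 * ((2 * m.+1).+1 * (2 * m.+1) * 'C((3 * m).+2, (2 * m.+1).+1))%:R).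
  rewrite -bin_moment0 -bin_moment1 -bin_moment2 !natr_sum !mulr_sumr -sumrN -!big_split /=.
  apply: eq_bigr => -[[|j] lt_j] _; rewrite !natrM; first by rewrite /=; ring.
  by rewrite /=; ring.
have x0 : x != 0 by rewrite pnatr_eq0.
set B : rat := 'C(3 * m.+1, 2 * m.+1)%:R.
(* All three moments are rational multiples of the one binomial [B]. *)
have e0 : x * 'C((3 * m.+1).+1, (2 * m.+1).+1)%:R = (3 * m.+1).+1%:R * B.
  by rewrite -!natrM -mul_bin_diag.
have e1 : x * 'C(3 * m.+1, (2 * m.+1).+1)%:R = m.+1%:R * B.
  rewrite -!natrM mul_bin_left; congr (_ * _)%:R; lia.
have e2 : 3 * (x * 'C((3 * m).+2, (2 * m.+1).+1)%:R) = m%:R * B.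
  have h1 : ((2 * m.+1).+1 * 'C((3 * m).+2, (2 * m.+1).+1) = m * 'C((3 * m).+2, 2 * m.+1))%N.
    by rewrite mul_bin_left; congr (_ * _)%N; lia.
  have h2 : (3 * 'C((3 * m).+2, 2 * m.+1) = 'C(3 * m.+1, 2 * m.+1))%N.
    have := mul_bin_down (3 * m.+1) (2 * m.+1).
    rewrite (_ : (3 * m.+1).-1 = (3 * m).+2)%N; last by lia.
    rewrite (_ : 3 * m.+1 - 2 * m.+1 = m.+1)%N; last by lia.
    by move/eqP; rewrite [(3 * m.+1)%N]mulnC -mulnA eqn_pmul2l // => /eqP.
  by rewrite -natrM h1 natrM mulrCA -natrM h2.
rewrite natrM -/x e1 2!natrM -/x.
rewrite (_ : x ^+ 2 * _ = x * ((3 * m.+1).+1%:R * B)); last by rewrite -e0; ring.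
rewrite (_ : _ * _ * _ = 2 * m.+1%:R * (m%:R * B) / 3); last first.
  by rewrite -e2; field.
(* With M = m+1, the coefficient of [B] is (2M+1)(3M+1) + (4M-2)M - 8M(M-1)/3 = (11M+3)(2M+1)/3;
   this is the source of 11n+3. *)
by rewrite /x; field.
Qed.

(** * Closed form of the partial sums *)

Definition ram_factor (m : nat) : rat :=
  24 * poch (1/2) m.+1 ^+ 3 / (m`!%:R * (2 * m).+1`!%:R).

Lemma ram_factorS m :
  ram_factor m.+1 = ram_factor m * (2 * m.+1).+1%:R ^+ 2 / (16 * m.+1%:R ^+ 2).
Proof.
rewrite /ram_factor pochS (_ : (2 * m.+1) = (2 * m).+2)%N; last by lia.
rewrite (factS m) (factS (2 * m).+2) (factS (2 * m).+1).
have f0 := fact_neq0 m; have f1 := fact_neq0 (2 * m).+1.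
move: ((2 * m).+1`!) f1 => F f1.
have m_ge0 := ler0n rat m.
field; rewrite f0 f1.
by do ?[apply/andP; split] => //; apply: lt0r_neq0; lra.
Qed.

Lemma odd_natr_neq0 (m j : nat) : (2 * m).+1%:R - 2 * j%:R != 0 :> rat.
Proof.
by rewrite -natrM subr_eq0 eqr_nat; apply/eqP; lia.
Qed.

(** Bookkeeping for the induction on [m]: term j of the old sum is matched with term j+1 of the new
    one, whose term 0 stands alone. *)
Lemma sum_shift_step (a b t : nat -> rat) (u v w : rat) n :
  v * b 0%N = w * t 0%N ->
  (forall j, (j < n)%N -> v * b j.+1 = u * a j + w * t j.+1) ->
  u * (\sum_(j < n) a j) + w * (\sum_(j < n.+1) t j) = v * \sum_(j < n.+1) b j.
Proof.
move=> b0 bS; rewrite !big_ord_recl /= !mulrDr b0 addrCA !mulr_sumr -big_split.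
by congr (_ + _); apply: eq_bigr => j _; rewrite bS.
Qed.

(** Absorption in both binomials; C(2m+2,j) must then be lowered to C(2m+1,j), whence the factor
    2m+3-(j+1). *)
Lemma bin_prod_shift m j : (j <= m)%N ->
  j.+1%:R ^+ 2 * ((2 * m.+1).+1%:R - j.+1%:R) *
    ('C(m.+1, j.+1) * 'C((2 * m.+1).+1, j.+1))%:R
  = 2 * m.+1%:R ^+ 2 * (2 * m.+1).+1%:R * ('C(m, j) * 'C((2 * m).+1, j))%:R :> rat.
Proof.
move=> le_jm.
have e1 := mul_bin_diag m.+1 j.
have e2 := mul_bin_diag (2 * m.+1).+1 j.
have e3 := mul_bin_down (2 * m.+1) j.
rewrite (_ : (2 * m.+1).-1 = (2 * m).+1)%N in e3; last by lia.
have le_j : (j <= 2 * m.+1)%N by lia.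
have -> : (2 * m.+1).+1%:R - j.+1%:R = (2 * m.+1 - j)%:R :> rat by rewrite natrB //; ring.
have -> : 2 * m.+1%:R ^+ 2 * (2 * m.+1).+1%:R = (m.+1 * (2 * m.+1) * (2 * m.+1).+1)%:R :> rat by ring.
rewrite -natrX -!natrM; congr _%:R.
transitivity ((j.+1 * 'C(m.+1, j.+1)) * (2 * m.+1 - j) * (j.+1 * 'C((2 * m.+1).+1, j.+1)))%N.
  by ring.
rewrite -e1 -e2 /=.
transitivity (m.+1 * 'C(m, j) * (2 * m.+1).+1 * ((2 * m.+1 - j) * 'C(2 * m.+1, j)))%N.
  by ring.
by rewrite -e3; ring.
Qed.

(** What multiplies the quadratic once the denominator has cancelled in the difference of
    consecutive right-hand sides. *)
Definition ram_weight (m : nat) : rat :=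
  ram_factor m / (16 * m.+1%:R ^+ 2 * (2 * m.+1).+1%:R).

Lemma ram_coefS m : ram_coef m.+1 * (11 * m.+1%:R + 3) =
  ram_weight m *
  \sum_(j < m.+2) ('C(m.+1, j) * 'C((2 * m.+1).+1, j))%:R *
     ((2 * m.+1).+1%:R ^+ 2 + 2 * j%:R * (2 * m.+1).+1%:R - 4 * j%:R ^+ 2).
Proof.
rewrite bin_weighted_sum ram_coefE /ram_weight /ram_factor.
rewrite (_ : (2 * m.+1) = (2 * m).+2)%N; last by lia.
rewrite (factS m) (factS (2 * m).+1).
have f0 := fact_neq0 m; have f1 := fact_neq0 (2 * m).+1.
move: ((2 * m).+1`!) f1 => F f1.
move: ('C(_, _)) (poch _ _) => B P.
have m_ge0 := ler0n rat m.
field; rewrite f0 f1.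
by do ?[apply/andP; split] => //; apply: lt0r_neq0; lra.
Qed.

Lemma ram_sumE m :
  \sum_(n < m.+1) ram_coef n * (11 * n%:R + 3) =
  ram_factor m * \sum_(j < m.+1)
    ('C(m, j) * 'C((2 * m).+1, j))%:R / ((2 * m).+1%:R - 2 * j%:R).
Proof.
elim: m => [|m IHm].
  rewrite !big_ord1 /= /ram_coef /ram_factor /poch !big_ord1 !big_ord0 /=.
  by rewrite !expr0 !bin0 !factS fact0; field.
rewrite big_ord_recr /= {}IHm ram_coefS.
have m_ge0 := ler0n rat m.
pose f k j : rat := ('C(k, j) * 'C((2 * k).+1, j))%:R.
apply: (@sum_shift_step (fun j => f m j / ((2 * m).+1%:R - 2 * j%:R))
  (fun j => f m.+1 j / ((2 * m.+1).+1%:R - 2 * j%:R))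
  (fun j => f m.+1 j * ((2 * m.+1).+1%:R ^+ 2 + 2 * j%:R * (2 * m.+1).+1%:R - 4 * j%:R ^+ 2))).
  rewrite ram_factorS /ram_weight /f !bin0; move: (ram_factor m) => c.
  by field; do ?[apply/andP; split] => //; apply: lt0r_neq0; lra.
(* The matched terms share their denominator, since (2m+3) - 2(j+1) = (2m+1) - 2j; it is odd, hence
   nonzero. *)
move=> j lt_j; have d0 := odd_natr_neq0 m j.
have h := bin_prod_shift m j lt_j.
rewrite ram_factorS /ram_weight; move: (ram_factor m) => c.
rewrite -/(f m j) -/(f m.+1 j.+1) in h.
move: (f m j) (f m.+1 j.+1) h => B A h.
have -> : B = j.+1%:R ^+ 2 * ((2 * m.+1).+1%:R - j.+1%:R) * A / (2 * m.+1%:R ^+ 2 * (2 * m.+1).+1%:R).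
  by rewrite h; field; do ?[apply/andP; split] => //; apply: lt0r_neq0; lra.
field; rewrite (_ : _ - _ = (2 * m).+1%:R - 2 * j%:R); last by ring.
by rewrite d0 andbT; apply/andP; split; apply: lt0r_neq0; lra.
Qed.

(** * Closure properties of p-integral rationals *)

Lemma p_integral_frac p (a : int) (d : nat) :
  coprime p d -> p_integral p (a%:~R / d%:R).
Proof.
move=> co_pd; rewrite /p_integral.
have [->|d_gt0] := posnP d; first by rewrite invr0 mulr0 coprimen1.
set x := _ / _.
(* Cross-multiplication and coprimality of [numq x] and [denq x] give this divisibility. *)
suff: (`|denq x| %| d)%N by move/coprime_dvdr; apply.
have d0 : (d%:R : rat) != 0 by rewrite pnatr_eq0 -lt0n.
have: numq x * d%:Z = a * denq x.
  apply: (@intr_inj rat); rewrite !intrM numqE /x -pmulrn mulrAC.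
  by rewrite divfK.
move/(congr1 absz); rewrite !abszM /= => e.
have := dvdn_mull `|a| (dvdnn `|denq x|).
by rewrite -e Gauss_dvdr // coprime_sym coprime_num_den.
Qed.

Lemma p_integral_ex {p x} : p_integral p x ->
  exists a (d : nat), coprime p d /\ x = a%:~R / d%:R.
Proof.
move=> px; exists (numq x), `|denq x|%N; split=> //.
by rewrite -[LHS]divq_num_den pmulrn absz_denq.
Qed.

Lemma p_integralD p x y : p_integral p x -> p_integral p y -> p_integral p (x + y).
Proof.
case/p_integral_ex=> a [d [co_d ->]] /p_integral_ex[b [e [co_e ->]]].
have [d0|d_gt0] := posnP d; first by rewrite d0 invr0 mulr0 add0r p_integral_frac.
have [e0|e_gt0] := posnP e; first by rewrite e0 invr0 mulr0 addr0 p_integral_frac.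
rewrite addf_div ?pnatr_eq0 -?lt0n //.
rewrite -natrM -[e%:R]/(e%:Z%:~R) -[d%:R]/(d%:Z%:~R) -!intrM -intrD.
by rewrite p_integral_frac // coprimeMr co_d.
Qed.

Lemma p_integralM p x y : p_integral p x -> p_integral p y -> p_integral p (x * y).
Proof.
case/p_integral_ex=> a [d [co_d ->]] /p_integral_ex[b [e [co_e ->]]].
by rewrite mulf_div -intrM -natrM p_integral_frac // coprimeMr co_d.
Qed.

Lemma p_integral_int p (a : int) : p_integral p a%:~R.
Proof. rewrite -[_%:~R]divr1; exact: (p_integral_frac p a 1 (coprimen1 p)). Qed.

Lemma p_integral_nat p n : p_integral p n%:R.
Proof. exact: (p_integral_int p n). Qed.

Lemma p_integralN p x : p_integral p x -> p_integral p (- x).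
Proof. by rewrite -mulN1r; apply: p_integralM; apply: (p_integral_int p (-1)). Qed.

Lemma p_integralX p x n : p_integral p x -> p_integral p (x ^+ n).
Proof.
move=> px; elim: n => [|n IHn]; first exact: (p_integral_nat p 1).
by rewrite exprS p_integralM.
Qed.

Lemma p_integral_natV p n : coprime p n -> p_integral p n%:R^-1.
Proof. by move=> co_pn; rewrite -[_^-1]mul1r; apply: (p_integral_frac p 1). Qed.

Lemma p_integral_sum p (I : Type) (r : seq I) (P : pred I) (F : I -> rat) :
  (forall i, P i -> p_integral p (F i)) -> p_integral p (\sum_(i <- r | P i) F i).
Proof.
by move=> pF; apply: (big_ind (fun x => p_integral p x)) => //; [exact: (p_integral_nat p 0) | exact: p_integralD].
Qed.

Lemma p_integral_prod p (I : Type) (r : seq I) (P : pred I) (F : I -> rat) :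
  (forall i, P i -> p_integral p (F i)) -> p_integral p (\prod_(i <- r | P i) F i).
Proof.
by move=> pF; apply: (big_ind (fun x => p_integral p x)) => //; [exact: (p_integral_nat p 1) | exact: p_integralM].
Qed.

Ltac p_integrality :=
  lazymatch goal with
  | |- is_true (p_integral _ (_ + _)) => apply: p_integralD; p_integrality
  | |- is_true (p_integral _ (_ * _)) => apply: p_integralM; p_integrality
  | |- is_true (p_integral _ (- _)) => apply: p_integralN; p_integrality
  | |- is_true (p_integral _ (_ ^+ _)) => apply: p_integralX; p_integrality
  | |- is_true (p_integral ?p (1 *+ ?n)) => exact: (p_integral_nat p n)
  | |- is_true (p_integral ?p 1) => exact: (p_integral_nat p 1)
  | |- _ => assumption
  end.

Lemma prime_coprime_small p n : prime p -> (0 < n < p)%N -> coprime p n.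
Proof.
move=> pr_p /andP[n_gt0 lt_np].
by rewrite prime_coprime // gtnNdvd.
Qed.

Lemma p_integral_factV p n : prime p -> (n < p)%N -> p_integral p n`!%:R^-1.
Proof.
move=> pr_p; elim: n => [|n IHn] lt_np; first by rewrite invr1 (p_integral_nat p 1).
rewrite factS natrM invfM p_integralM ?IHn ?(ltnW lt_np) //.
by rewrite p_integral_natV // prime_coprime_small.
Qed.

(** * Products symmetric about a centre, modulo p^2 *)

Lemma prod_centered (x : rat) h :
  \prod_(k < (2 * h).+1) (x - h%:R + k%:R) = x * \prod_(i < h) (x ^+ 2 - i.+1%:R ^+ 2).
Proof.
elim: h => [|h IHh]; first by rewrite big_ord1 big_ord0 /=; ring.
rewrite (_ : (2 * h.+1).+1 = (2 * h).+3)%N; last by lia.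
(* The outermost factors x-(h+1) and x+(h+1) pair up; the inner ones form the product for [h]. *)
rewrite big_ord_recl big_ord_recr [in RHS]big_ord_recr /=.
rewrite (eq_bigr (fun k : 'I_(2 * h).+1 => x - h%:R + k%:R)); last first.
  by move=> k _; rewrite /bump /=; ring.
by rewrite IHh /bump /=; ring.
Qed.

(** Q and R are its values at y = p^2/4 and y = p^2. *)
Definition sqr_prod (h : nat) (y : rat) : rat := \prod_(i < h) (i.+1%:R ^+ 2 - y).

Lemma prod_sub_sqr h y :
  \prod_(i < h) (y - i.+1%:R ^+ 2) = (-1) ^+ h * sqr_prod h y.
Proof.
rewrite /sqr_prod -[h in (-1) ^+ h]card_ord -prodrN.
by apply: eq_bigr => i _; rewrite opprB.
Qed.

(** Each factor changes only by a multiple of p^2. Used with x = 1/4 for Q and x = 1 for R. *)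
Lemma sqr_prod_congr p x h : p_integral p x ->
  p_integral p ((sqr_prod h (p%:R ^+ 2 * x) - h`!%:R ^+ 2) / p%:R ^+ 2).
Proof.
move=> px; rewrite /sqr_prod.
have [->|p_gt0] := posnP p; first by rewrite expr0n invr0 mulr0 (p_integral_nat 0 0).
have p0 : (p%:R : rat) != 0 by rewrite pnatr_eq0 -lt0n.
elim: h => [|h IHh].
  by rewrite big_ord0 expr1n subrr mul0r (p_integral_nat p 0).
rewrite big_ord_recr factS natrM /=; set P := \prod_(i < h) _ in IHh *.
set t := (_ / _) in IHh.
have eP : P = h`!%:R ^+ 2 + p%:R ^+ 2 * t by rewrite /t; field.
rewrite (_ : _ / _ = h.+1%:R ^+ 2 * t - x * (h`!%:R ^+ 2 + p%:R ^+ 2 * t)); last first.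
  by rewrite eP; move: (h`!) => F; field.
by move: t IHh {eP} => t pt; p_integrality.
Qed.

Lemma fact_addn n k : (n + k)`!%:R = n`!%:R * \prod_(i < k) (n.+1%:R + i%:R) :> rat.
Proof.
elim: k => [|k IHk]; first by rewrite addn0 big_ord0 mulr1.
rewrite addnS factS natrM IHk big_ord_recr /=.
by move: (n`!) => F; ring.
Qed.

(** * The terms off the centre *)

Lemma bin_prod_congr m j : prime m.+1 -> (j <= m)%N ->
  p_integral m.+1 ((('C(m, j) * 'C((2 * m).+1, j))%:R - 1) / m.+1%:R).
Proof.
move=> pr_p; have p0 := natrS_neq0 m.
elim: j => [|j IHj] le_jm; first by rewrite !bin0 subrr mul0r (p_integral_nat _ 0).
have := IHj (ltnW le_jm); rewrite !natrM; set t := _ / _ => pt.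
have j0 := natrS_neq0 j.
have pq : p_integral m.+1 j.+1%:R^-1.
  by rewrite p_integral_natV // prime_coprime_small.
have e1 : j.+1%:R * 'C(m, j.+1)%:R = (m%:R - j%:R) * 'C(m, j)%:R :> rat.
  by rewrite -natrM mul_bin_left natrM natrB // ltnW.
have e2 : j.+1%:R * 'C((2 * m).+1, j.+1)%:R = ((2 * m).+1%:R - j%:R) * 'C((2 * m).+1, j)%:R :> rat.
  by rewrite -natrM mul_bin_left natrM natrB //; lia.
have et : 'C(m, j)%:R * 'C((2 * m).+1, j)%:R = 1 + m.+1%:R * t.
  by rewrite /t [m.+1%:R * _]mulrC divfK // addrC subrK.
(* With p = m+1, consecutive products have ratio (1 - p/(j+1))(1 - 2p/(j+1)), which is 1 mod p. *)
rewrite (_ : _ / _ = t * (1 - m.+1%:R / j.+1%:R) * (1 - 2 * m.+1%:R / j.+1%:R)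
    - 3 / j.+1%:R + 2 * m.+1%:R / j.+1%:R ^+ 2); last first.
  have -> : 'C(m, j.+1)%:R * 'C((2 * m).+1, j.+1)%:R =
     (m%:R - j%:R) * ((2 * m).+1%:R - j%:R) * (1 + m.+1%:R * t) / j.+1%:R ^+ 2.
    rewrite -et; apply: (mulfI (expf_neq0 2 j0)).
    rewrite [RHS]mulrC divfK ?expf_neq0 //.
    rewrite expr2 mulrACA e1 e2; ring.
  move: t {pt et} => t; field.
  by have := ler0n rat m; have := ler0n rat j => *; apply/andP; split; apply: lt0r_neq0; lra.
by rewrite -!exprVn; move: t pt {et} => t pt; p_integrality.
Qed.

(** The only positive multiple of p = 2h+1 below 2p is p itself, which would force a = h. *)
Lemma coprime_odd_lt2p h a : prime (2 * h).+1 -> (a <= 2 * h)%N -> a != h ->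
  coprime (2 * h).+1 (2 * a).+1.
Proof.
move=> pr_p le_a ne_a; rewrite prime_coprime //.
apply/negP => /dvdnP[[|[|k]] e]; move/eqP: ne_a; [lia | lia | nia].
Qed.

(** Reversing j to 2h-j turns the denominator d_j into 2j+1, and d_j + (2j+1) = 2p. Averaging the
    two forms therefore produces a factor p that cancels the division by p. *)
Lemma sum_odd_inv (h : nat) :
  \sum_(j < (2 * h).+1 | j != h :> nat) ((2 * (2 * h)).+1%:R - 2 * j%:R)^-1 / (2 * h).+1%:R
  = \sum_(j < (2 * h).+1 | j != h :> nat)
      ((2 * (2 * h)).+1%:R - 2 * j%:R)^-1 / (2 * j).+1%:R :> rat.
Proof.
set d := fun j : nat => (2 * (2 * h)).+1%:R - 2 * j%:R : rat.
have p0 := natrS_neq0 (2 * h).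
apply: (@mulrI _ 2) => //.
have e : \sum_(j < (2 * h).+1 | j != h :> nat) (d j)^-1 / (2 * h).+1%:R
  = \sum_(j < (2 * h).+1 | j != h :> nat) (2 * j).+1%:R^-1 / (2 * h).+1%:R.
  rewrite (reindex_inj rev_ord_inj) /=; apply: eq_big => j.
    by have := ltn_ord j => lt_j; apply/idP/idP; lia.
  move=> _; congr (_^-1 / _); rewrite /d subSS natrB; last by rewrite -ltnS.
  by ring.
rewrite mulr2n mulrDl !mul1r {1}e -big_split /= mulrDl !mul1r -big_split /=.
apply: eq_bigr => j _.
have := odd_natr_neq0 (2 * h) j; rewrite -/(d j) => d0.
have j0 := natrS_neq0 (2 * j).
rewrite -[X in _ = X + _]mulr1 -[X in _ = _ + X]mulr1 -mulrDr.
have -> : d j = 2 * (2 * h).+1%:R - (2 * j).+1%:R by rewrite /d; ring.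
field; rewrite (_ : _ - _ = d j); last by rewrite /d; ring.
have h_ge0 := ler0n rat h; have j_ge0 := ler0n rat j.
by rewrite d0; apply/andP; split; apply: lt0r_neq0; lra.
Qed.

(** Writing each binomial product as 1 + p t separates a sum with integral t from the sum of
    reciprocals treated by [sum_odd_inv]. *)
Lemma off_center_sum_integral (h : nat) : prime (2 * h).+1 ->
  p_integral (2 * h).+1
    ((\sum_(j < (2 * h).+1 | j != h :> nat)
       ('C(2 * h, j) * 'C((2 * (2 * h)).+1, j))%:R / ((2 * (2 * h)).+1%:R - 2 * j%:R))
     / (2 * h).+1%:R).
Proof.
move=> pr_p; pose d j : rat := (2 * (2 * h)).+1%:R - 2 * j%:R.
pose t j : rat := (('C(2 * h, j) * 'C((2 * (2 * h)).+1, j))%:R - 1) / (2 * h).+1%:R.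
have p0 := natrS_neq0 (2 * h).
have pd (j : 'I_(2 * h).+1) : j != h :> nat -> p_integral (2 * h).+1 (d j)^-1.
  move=> ne_j; have lt_j := ltn_ord j.
  have -> : d j = (2 * (2 * h - j)).+1%:R by rewrite /d -natrM -natrB; [congr _%:R|]; lia.
  by rewrite p_integral_natV // coprime_odd_lt2p //; lia.
rewrite mulr_suml (eq_bigr (fun j : 'I_(2 * h).+1 =>
    t j * (d j)^-1 + (d j)^-1 / (2 * h).+1%:R)); last first.
  by move=> j _; rewrite /t mulrBl -/(d j); move: (_%:R : rat) ((d j)^-1) => f e; ring.
rewrite big_split /= sum_odd_inv.
apply: p_integralD; apply: p_integral_sum => j ne_j; apply: p_integralM.
- by apply: bin_prod_congr => //; rewrite -ltnS.
- exact: pd.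
- exact: pd.
by rewrite p_integral_natV // coprime_odd_lt2p // -ltnS.
Qed.

(** * The prefactor and the central term *)

Lemma poch_half_odd h :
  poch (1 / 2) (2 * h).+1 =
  (2 * h).+1%:R / 2 * ((-1) ^+ h * sqr_prod h ((2 * h).+1%:R ^+ 2 * 4^-1)).
Proof.
have -> : (2 * h).+1%:R ^+ 2 * 4^-1 = ((2 * h).+1%:R / 2) ^+ 2 :> rat by field.
(* The factors 1/2 + k are centred at p/2, as p/2 - h = 1/2. *)
rewrite -prod_sub_sqr -prod_centered /poch; apply: eq_bigr => k _.
by congr (_ + _); field.
Qed.

(** The last p factors of (p+h)!, from h+1 to 3h+1, are centred at p. *)
Lemma fact_center h :
  ((2 * h).+1 + h)`!%:R =
  h`!%:R * (2 * h).+1%:R * ((-1) ^+ h * sqr_prod h ((2 * h).+1%:R ^+ 2 * 1)) :> rat.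
Proof.
rewrite mulr1 -prod_sub_sqr addnC fact_addn -mulrA -prod_centered; congr (_ * _).
by apply: eq_bigr => k _; ring.
Qed.

Lemma sqr_prod_neq0 h : sqr_prod h ((2 * h).+1%:R ^+ 2 * 1) != 0.
Proof.
apply: contraNneq (fact_neq0 ((2 * h).+1 + h)) => R0.
by rewrite fact_center R0 !mulr0.
Qed.

(** Up to sign each factor is (p-i)(p+i) with 1 <= i <= h, prime to p. *)
Lemma sqr_prodV_integral h : prime (2 * h).+1 ->
  p_integral (2 * h).+1 (sqr_prod h ((2 * h).+1%:R ^+ 2 * 1))^-1.
Proof.
move=> pr_p; rewrite /sqr_prod -prodfV; apply: p_integral_prod => i _.
have lt_i := ltn_ord i.
have -> : i.+1%:R ^+ 2 - (2 * h).+1%:R ^+ 2 * 1 =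
    - ((2 * h - i)%:R * ((2 * h).+1 + i.+1)%:R) :> rat.
  by rewrite natrB; [ring | lia].
rewrite invrN invfM; apply/p_integralN/p_integralM; apply: p_integral_natV.
  by rewrite prime_coprime_small //; lia.
by rewrite prime_coprime // dvdn_addr // gtnNdvd //; lia.
Qed.

(** The binomials turn the denominator (2h)! (4h+1)! into h!^3 (p+h)!, where [fact_center] exposes p
    and R; 24 (p/2)^3 = 3 p^3, and the signs cancel. *)
Lemma ram_factor_center h :
  ram_factor (2 * h) * ('C(2 * h, h) * 'C((2 * (2 * h)).+1, h))%:R =
  3 * (2 * h).+1%:R ^+ 2 * sqr_prod h ((2 * h).+1%:R ^+ 2 * 4^-1) ^+ 3 /
    (h`!%:R ^+ 4 * sqr_prod h ((2 * h).+1%:R ^+ 2 * 1)).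
Proof.
have c1 : 'C(2 * h, h)%:R * (h`!%:R * h`!%:R) = (2 * h)`!%:R :> rat.
  rewrite -!natrM -(@bin_fact (2 * h) h); last by lia.
  by rewrite (_ : 2 * h - h = h)%N //; lia.
have c2 : 'C((2 * (2 * h)).+1, h)%:R * (h`!%:R * ((2 * h).+1 + h)`!%:R) =
    (2 * (2 * h)).+1`!%:R :> rat.
  rewrite -!natrM -(@bin_fact (2 * (2 * h)).+1 h); last by lia.
  by rewrite (_ : (2 * (2 * h)).+1 - h = (2 * h).+1 + h)%N //; lia.
rewrite /ram_factor poch_half_odd natrM -c1 -c2 fact_center.
have R0 := sqr_prod_neq0 h; have f0 := fact_neq0 h.
have b1 : 'C(2 * h, h)%:R != 0 :> rat by rewrite pnatr_eq0 -lt0n bin_gt0; lia.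
have b2 : 'C((2 * (2 * h)).+1, h)%:R != 0 :> rat by rewrite pnatr_eq0 -lt0n bin_gt0; lia.
have p0 := natrS_neq0 (2 * h).
have e3 : ((-1) ^+ h) ^+ 3 = (-1) ^+ h :> rat by rewrite exprS sqrr_sign mulr1.
have e0 : (-1) ^+ h != 0 :> rat by rewrite signr_eq0.
rewrite !exprMn {}e3; move: R0 f0 b1 b2 p0 e0.
move: (sqr_prod _ _) => R; move: (sqr_prod _ _) (h`!) => Q F.
move: 'C(2 * h, h) 'C(_, h) ((2 * h).+1%:R : rat) ((-1) ^+ h : rat).
move=> B C p e R0 f0 b1 b2 p0 e0.
by field; rewrite ?R0 ?f0 ?b1 ?b2 ?p0 ?e0.
Qed.

Lemma p_integral_4V h : p_integral (2 * h).+1 4^-1.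
Proof.
apply: (p_integral_natV _ 4); rewrite coprime_sym.
by rewrite (coprimeXl 2 (m := 2)) // coprime2n /= mul2n odd_double.
Qed.

Lemma ram_factor_integral h : prime (2 * h).+1 ->
  p_integral (2 * h).+1 (ram_factor (2 * h) / (2 * h).+1%:R ^+ 2).
Proof.
move=> pr_p; have p0 := natrS_neq0 (2 * h).
have e3 : ((-1) ^+ h) ^+ 3 = (-1) ^+ h :> rat by rewrite exprS sqrr_sign mulr1.
rewrite /ram_factor (_ : (2 * (2 * h)).+1 = 2 * h + (2 * h).+1)%N; last by lia.
(* (2p-1)! = (p-1)! p X, with X the product of p+1, ..., 2p-1. Its single factor p against the p^3
   of the cube leaves p^2. *)
rewrite (fact_addn (2 * h) (2 * h).+1) big_ord_recl /= addr0 poch_half_odd !exprMn e3.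
set Q := sqr_prod _ _; set X := \prod_(i < _) _.
have pQ : p_integral (2 * h).+1 Q.
  apply: p_integral_prod => i _; have := p_integral_4V h => p4; p_integrality.
have pX : p_integral (2 * h).+1 X^-1.
  rewrite -prodfV; apply: p_integral_prod => i _.
  rewrite -natrD p_integral_natV // prime_coprime // dvdn_addr // gtnNdvd //.
  by rewrite /bump /= add1n ltnS.
have pF := p_integral_factV _ _ pr_p (ltnSn (2 * h)).
have ps : p_integral (2 * h).+1 (-1) by apply: (p_integral_int _ (-1)).
have X0 : X != 0.
  by apply/prodf_neq0 => i _; rewrite -natrD pnatr_eq0.
have F0 := fact_neq0 (2 * h).
rewrite (_ : _ / _ = 3 * (-1) ^+ h * Q ^+ 3 * (2 * h)`!%:R^-1 ^+ 2 * X^-1).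
  by p_integrality.
move: {pQ pX e3} p0 F0 X0; move: Q X ((2 * h)`!%:R : rat) ((2 * h).+1%:R : rat) ((-1) ^+ h : rat).
by move=> Q X F p e p0 F0 X0; field; rewrite p0 F0 X0.
Qed.

(** * The congruence modulo p^3 *)

Theorem theorem1p3 (p : nat) (hp : prime p) (hp2 : (2 < p)%N) :
  rat_congr p ((p%:R : rat) ^+ 3)
    (\sum_(n < p)
        (poch (1/2) n * poch (1/3) n * poch (2/3) n / (poch 1 n) ^+ 3)
        * (11 * n%:R + 3) * (27/16) ^+ n)
    (3 * p%:R).
Proof.
rewrite /rat_congr.
rewrite (eq_bigr (fun n : 'I_p => ram_coef n * (11 * n%:R + 3))); last first.
  by move=> n _; rewrite /ram_coef mulrAC.
have [h def_p] : exists h, p = (2 * h).+1.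
  case: (even_prime hp) => [p2|odd_p]; first by rewrite p2 in hp2.
  by exists p./2; lia.
subst p; rewrite ram_sumE.
have lt_h : (h < (2 * h).+1)%N by lia.
(* The term j = h, whose denominator is p, is split off. *)
rewrite (bigD1 (Ordinal lt_h)) //=.
rewrite (eq_bigl (fun j : 'I_(2 * h).+1 => j != h :> nat)) //.
have := off_center_sum_integral h hp.
have := ram_factor_center h.
have := ram_factor_integral h hp.
have := sqr_prod_congr (2 * h).+1 4^-1 h (p_integral_4V h).
have := sqr_prod_congr (2 * h).+1 1 h (p_integral_nat _ 1).
have := sqr_prodV_integral h hp; have := sqr_prod_neq0 h.
have := p_integral_factV _ _ hp lt_h; have := fact_neq0 h.
have -> : (2 * (2 * h)).+1%:R - 2 * h%:R = (2 * h).+1%:R :> rat by ring.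
have := natrS_neq0 (2 * h).
move: (ram_factor _) (('C(2 * h, h) * _)%:R : rat) (\sum_(j < _ | _) _) => c f S.
move: (sqr_prod _ _) => R; move: (sqr_prod _ _) => Q.
have := p_integral_nat (2 * h).+1 (2 * h).+1; have := p_integral_nat (2 * h).+1 h`!.
move: (h`!%:R : rat) ((2 * h).+1%:R : rat) => F p pF pp p0 F0 pFV R0 pRV.
set b := (R - _) / _; set a := (Q - _) / _ => pb pa pe ecf pSp.
(* The bracket is (Q^3 - F^4 R)/p^2 expanded with Q = F^2 + p^2 a and R = F^2 + p^2 b; the first
   summand is the off-centre part. *)
have -> : (c * (f / p + S) - 3 * p) / p ^+ 3 =
    c / p ^+ 2 * (S / p) +
    3 * (3 * F ^+ 4 * a + 3 * F ^+ 2 * p ^+ 2 * a ^+ 2 + p ^+ 4 * a ^+ 3 - F ^+ 4 * b)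
      * F^-1 ^+ 4 * R^-1.
  have -> : (c * (f / p + S) - 3 * p) / p ^+ 3 =
      c / p ^+ 2 * (S / p) + (c * f / p ^+ 2 - 3) / p ^+ 2 by field.
  rewrite ecf; congr (_ + _).
  by rewrite /a /b; field; rewrite p0 F0 R0.
by move: a b pa pb => a b pa pb; apply: p_integralD; [exact: p_integralM | p_integrality].
Qed.
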